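(* One has $f(3,5)\le146$, $f(3,6)\le255$, and $f(3,7)\le474$.
   Context: $f(w,k)$ denotes the maximum size of a finite family of distinct $w$-element sets (on an arbitrary finite ground set) containing no $k$-sunflower. A $k$-sunflower is a collection of $k$ distinct sets $A_1,\dots,A_k$ for which there is a set $C$ (the core, possibly empty) with $A_i\cap A_j=C$ for all $i\ne j$. *)

(* Defs.v *)
From mathcomp Require Import all_boot.
From Stdlib Require Import Classical ClassicalEpsilon.

Set Implicit Arguments.
Unset Strict Implicit.
Unset Printing Implicit Defensive.

Definition sunflower (T : finType) (k : nat) (S : {set {set T}}) : Prop :=
  #|S| = k /\
  exists C : {set T},
    forall A B, A \in S -> B \in S -> A != B -> A :&: B = C.

Definition sunflower_free (T : finType) (k : nat) (F : {set {set T}}) : Prop :=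
  ~ exists S : {set {set T}}, S \subset F /\ sunflower k S.

Definition uniform (T : finType) (w : nat) (F : {set {set T}}) : Prop :=
  forall A, A \in F -> #|A| = w.

Definition family_size (w k m : nat) : Prop :=
  exists (T : finType) (F : {set {set T}}),
    [/\ uniform w F, sunflower_free k F & #|F| = m].

Definition max_family_size (w k m : nat) : Prop :=
  family_size w k m /\ forall n, family_size w k n -> n <= m.

(* For k > 0 the maximum exists, so that the choice is determined: see f_max
   and f_unique. For k = 0 every family contains the empty 0-sunflower, there
   is no maximum, and the value is unspecified. *)
Definition f (w k : nat) : nat := epsilon (inhabits 0) (max_family_size w k).

(* The Erdős–Rado bound, which shows that the maximum exists. *)
Lemma erdos_rado (T : finType) (w k : nat) (F : {set {set T}}) :
  uniform w F -> sunflower_free k.+1 F -> #|F| <= w`! * k ^ w.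
Proof.
elim: w F => [|w IHw] F unif free.
  rewrite fact0 expn0 muln1 -(cards1 (@set0 T)); apply: subset_leq_card.
  by apply/subsetP=> A /unif /cards0_eq ->; rewrite inE.
pose good (S : {set {set T}}) := (S \subset F) && trivIset S.
have good0 : good set0.
  by rewrite /good sub0set; apply/trivIsetP=> A B; rewrite inE.
have [S /maxsetP[/andP[SF /trivIsetP trS] maxS] _] := maxset_exists good0.
have cardS : #|S| <= k.
  rewrite leqNgt; apply/negP => /card_geqP [s [us sz sS]].
  apply: free; exists [set A in s]; split.
    by apply/subsetP=> A; rewrite inE => /sS; apply: (subsetP SF).
  split; first by rewrite cardsE (card_uniqP us).
  exists set0 => A B; rewrite !inE => /sS AS /sS BS AB.
  by apply/eqP; rewrite setI_eq0; apply: trS.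
have cardY : #|cover S| <= k * w.+1.
  apply: leq_trans (leq_card_cover S).1 _.
  rewrite (eq_bigr (fun=> w.+1)); last by move=> A /(subsetP SF) /unif.
  by rewrite sum_nat_const leq_mul2r cardS orbT.
have meet (A : {set T}) : A \in F -> exists2 y, y \in cover S & y \in A.
  move=> AF; case: (boolP [disjoint A & cover S]) => [dis|]; last first.
    by rewrite -setI_eq0 => /set0Pn [y /setIP[yA yS]]; exists y.
  have disS B : B \in S -> [disjoint A & B].
    by move=> BS; apply: disjointWr dis; apply: bigcup_sup.
  have AS : A \in S.
    rewrite -(maxS (A |: S)) ?setU11 ?subsetUr // /good subUset sub1set AF SF.
    apply/trivIsetP => B C /setU1P[->|BS] /setU1P[->|CS] neq.
    - by rewrite eqxx in neq.
    - exact: disS.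
    - by rewrite disjoint_sym; apply: disS.
    - exact: trS.
  have := disS A AS; rewrite -setI_eq0 setIid -cards_eq0.
  by rewrite (unif A AF).
pose F_ y := [set A in F | y \in A].
have cardF y : #|F_ y| <= w`! * k ^ w.
  have inj : {in F_ y &, injective (fun A => A :\ y)}.
    move=> A B; rewrite !inE => /andP[_ yA] /andP[_ yB] eqAB.
    by rewrite -(setD1K yA) eqAB setD1K.
  rewrite -(card_in_imset inj); apply: IHw.
    move=> _ /imsetP[A + ->]; rewrite inE => /andP[AF yA].
    by move: (unif A AF); rewrite (cardsD1 y) yA add1n => -[].
  move=> [Z [ZF [cardZ [C coreC]]]]; apply: free.
  have Zy B : B \in Z -> (y \notin B) /\ (y |: B \in F).
    move=> /(subsetP ZF) /imsetP[A]; rewrite inE => /andP[AF yA] ->.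
    by rewrite setD1K // setD11.
  have injZ : {in Z &, injective (fun B => y |: B)}.
    move=> B D /Zy [yB _] /Zy [yD _] eqBD.
    by rewrite -(setU1K yB) eqBD setU1K.
  exists [set y |: B | B in Z]; split.
    by apply/subsetP => _ /imsetP[B /Zy [_ ?] ->].
  split; first by rewrite card_in_imset.
  exists (y |: C) => _ _ /imsetP[B BZ ->] /imsetP[D DZ ->] neq.
  rewrite -setUIr coreC //; apply: contraNneq neq => ->; exact: eqxx.
have sub : F \subset \bigcup_(y in cover S) F_ y.
  apply/subsetP => A AF; have [y yS yA] := meet A AF.
  by apply/bigcupP; exists y => //; rewrite inE AF.
apply: leq_trans (subset_leq_card sub) _.
apply: (@leq_trans (\sum_(y in cover S) w`! * k ^ w)); last first.
  by rewrite sum_nat_const factS expnS mulnACA leq_mul2r (mulnC w.+1) cardY orbT.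
elim/big_rec2: _ => [|y m U _ leU]; first by rewrite cards0.
by apply: leq_trans (leq_card_setU _ _).1 _; apply: leq_add.
Qed.

Lemma f_max (w k : nat) : 0 < k -> max_family_size w k (f w k).
Proof.
case: k => // k _; apply: epsilon_spec.
have fs0 : family_size w k.+1 0.
  exists 'I_0, set0; split; [by move=> A; rewrite inE | | exact: cards0].
  by move=> [S []]; rewrite subset0 => /eqP-> []; rewrite cards0.
have bound n : family_size w k.+1 n -> n <= w`! * k ^ w.
  by move=> [T [F [unif free <-]]]; apply: erdos_rado.
elim: (w`! * k ^ w) bound => [|b IHb] bound; first by exists 0.
case: (classic (family_size w k.+1 b.+1)) => [fsb|nfsb]; first by exists b.+1.
apply: IHb => n fsn; move: (bound n fsn); rewrite leq_eqVlt ltnS.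
by case/orP=> // /eqP nb; case: nfsb; rewrite -nb.
Qed.

Lemma f_unique (w k m : nat) : max_family_size w k m -> f w k = m.
Proof.
move=> maxm; have [fsf maxf] : max_family_size w k (f w k).
  by apply: epsilon_spec; exists m.
by apply/eqP; rewrite eqn_leq maxm.2 ?maxf //; case: maxm.
Qed.

(* Main.v *)
Require Import Defs.
From mathcomp Require Import all_boot zify.

(** Let r = k - 1, let M be a maximum matching of a 3-uniform family F without
    k-sunflower, and V its vertex set. Every member of F meets V; counting the
    pairs (x, A) with x in A and V gives
      2|F| + |M| <= sum over x in V of (deg x + out x),
    where out x counts the triples meeting V exactly in x. The link of x is a
    graph with degrees and matching number at most r, so deg x is at most the
    Chvatal-Hanson bound g for such graphs. For {x, y, z} in M the edge {y, z}
    is disjoint from the outer link of x, whose matching number is therefore at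
    most r - 1, with corresponding bound h. By maximality of M the outer links
    of x, y, z are pairwise cross-intersecting, which gives
    out x + out y + out z <= h. Hence 2|F| <= r(3g + h - 1), and (g, h) is
    (20, 14), (27, 22), (42, 33) for r = 4, 5, 6. *)

Set Implicit Arguments.
Unset Strict Implicit.
Unset Printing Implicit Defensive.

Section Matchings.
Variable T : finType.
Implicit Types (E K M N : {set {set T}}) (A B e : {set T}) (u v w x : T).

(** * Matchings in a set family *)

Definition matching E M := (M \subset E) && trivIset M.

Definition degree E x := #|[set A in E | x \in A]|.

Lemma coverU1 A M : cover (A |: M) = A :|: cover M.
Proof. by rewrite /cover bigcup_setU big_set1. Qed.

Lemma coverS M N : M \subset N -> cover M \subset cover N.
Proof.
by move=> /subsetP MN; apply/bigcupsP => A /MN AN; apply: (bigcup_sup A).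
Qed.

Lemma mem_cover A M x : A \in M -> x \in A -> x \in cover M.
Proof. by move=> AM xA; apply/bigcupP; exists A. Qed.

Lemma disjoint_cover A M : A \in M -> [disjoint A & cover M] -> A = set0.
Proof.
move=> AM; rewrite -setI_eq0 => /eqP; rewrite (setIidPl _) //.
exact: (bigcup_sup A).
Qed.

Lemma trivIset_notin_coverD1 A M x :
  trivIset M -> A \in M -> x \in A -> x \notin cover (M :\ A).
Proof.
move=> /trivIsetP trM AM xA; apply/bigcupP => -[B /setD1P[BA BM] xB].
by have /disjointFr/(_ xB) := trM _ _ BM AM BA; rewrite xA.
Qed.

Lemma matching0 E : matching E set0.
Proof. by rewrite /matching sub0set; apply/trivIsetP => ? ?; rewrite inE. Qed.

Lemma matchingS E E' M : E \subset E' -> matching E M -> matching E' M.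
Proof. by move=> EE' /andP[ME trM]; rewrite /matching trM (subset_trans ME). Qed.

Lemma matchingD1 E M A : matching E M -> matching E (M :\ A).
Proof.
move=> /andP[ME trM]; rewrite /matching (subset_trans (subsetDl _ _) ME) /=.
exact: trivIsetS (subsetDl _ _) trM.
Qed.

Lemma matchingU1 E M A :
  matching E M -> A \in E -> [disjoint A & cover M] -> matching E (A |: M).
Proof.
move=> /andP[ME trM] AE disA; rewrite /matching subUset sub1set AE ME /=.
have disAB B : B \in M -> [disjoint A & B].
  by move=> BM; apply: disjointWr disA; apply: bigcup_sup.
apply/trivIsetP => B C /setU1P[->|BM] /setU1P[->|CM] neq.
- by rewrite eqxx in neq.
- exact: disAB.
- by rewrite disjoint_sym disAB.
- exact: (trivIsetP trM).
Qed.

(** The empty set is disjoint from every cover, even when it already belongs to [M]; hence the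
    condition on [A]. *)
Lemma card_matchingU1 M A :
  A != set0 -> [disjoint A & cover M] -> #|A |: M| = #|M|.+1.
Proof.
move=> A0 disA; rewrite cardsU1 (contraNN _ A0) // => AM.
by rewrite (disjoint_cover AM disA).
Qed.

(** * Edges as two-element sets, and the exchange between maximum matchings *)

Lemma set2_of_mem A v : #|A| = 2 -> v \in A -> exists2 a, a != v & A = [set v; a].
Proof.
move=> A2 vA; have /cards1P[a Aa] : #|A :\ v| == 1.
  by move: A2; rewrite (cardsD1 v) vA add1n => -[->].
exists a; last by rewrite -(setD1K vA) Aa.
have : a \in A :\ v by rewrite Aa set11.
by rewrite !inE => /andP[].
Qed.

Lemma disjoint_set2 a b (D : {set T}) :
  [disjoint [set a; b] & D] = (a \notin D) && (b \notin D).
Proof. by rewrite disjoints_subset subUset !sub1set !inE. Qed.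

Lemma disjoint_setU1 a A (D : {set T}) :
  [disjoint a |: A & D] = (a \notin D) && [disjoint A & D].
Proof. by rewrite !disjoints_subset subUset sub1set inE. Qed.

(* The exchange step of Gallai's lemma, by following the alternating path that
   starts at v two edges at a time. *)
Lemma matching_exchange n E M N u v w :
  uniform 2 E -> (forall K, matching E K -> #|K| <= n) ->
  matching E M -> #|M| = n -> matching E N -> #|N| = n -> u != w ->
  u \notin cover M -> w \notin cover M -> v \notin cover N ->
  exists K, [/\ matching E K, #|K| = n, v \notin cover K &
                (u \notin cover K) || (w \notin cover K)].
Proof.
elim: n E M N v => [|n IHn] E M N v E2 maxE mM cM mN cN uw uM wM vN.
  exists M; split=> //; last by rewrite uM.
  by rewrite (cards0_eq cM) /cover big_set0 inE.
have [/bigcupP[e eM ve]|vM] := boolP (v \in cover M); last first.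
  by exists M; rewrite uM.
have /andP[ME trM] := mM; have /andP[NE trN] := mN.
have eE := subsetP ME _ eM.
have [a av Ee] := set2_of_mem (E2 _ eE) ve.
have ae : a \in e by rewrite Ee !inE eqxx orbT.
have aM : a \in cover M by apply: mem_cover ae.
(* If [N] missed [a] as well as [v], it could be enlarged by [e]. So the path continues with an edge
   [e'] of [N] at [a]. *)
have [/bigcupP[e' e'N ae']|aN] := boolP (a \in cover N); last first.
  have dis : [disjoint e & cover N] by rewrite Ee disjoint_set2 vN.
  have e0 : e != set0 by apply/set0Pn; exists v.
  by have := maxE _ (matchingU1 mN eE dis); rewrite card_matchingU1 // cN ltnn.
have e'E := subsetP NE _ e'N.
have [b ba Ee'] := set2_of_mem (E2 _ e'E) ae'.
have e'0 : e' != set0 by apply/set0Pn; exists a.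
have be' : b \in e' by rewrite Ee' !inE eqxx orbT.
have vb : v != b by apply: contraNneq vN => ->; apply: mem_cover be'.
have va : v != a by rewrite eq_sym.
have ua : u != a by apply: contraNneq uM => ->.
have wa : w != a by apply: contraNneq wM => ->.
have cMe : #|M :\ e| = n by move: cM; rewrite (cardsD1 e) eM => -[].
have cNe : #|N :\ e'| = n by move: cN; rewrite (cardsD1 e') e'N => -[].
have coverMe := coverS (subsetDl M [set e]).
have vMe : v \notin cover (M :\ e) by apply: trivIset_notin_coverD1.
have aMe : a \notin cover (M :\ e) by apply: trivIset_notin_coverD1.
(* If [M] misses [b], replacing [e] by [e'] in [M] frees [v]; since [b] cannot equal both [u] and
   [w], one of these stays missed. *)
have [bM|bM] := boolP (b \in cover M); last first.
  have dis : [disjoint e' & cover (M :\ e)].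
    by rewrite Ee' disjoint_set2 aMe (contraNN (subsetP coverMe b)).
  exists (e' |: (M :\ e)); split.
  - exact: matchingU1 (matchingD1 _ mM) e'E dis.
  - by rewrite card_matchingU1 // cMe.
  - by rewrite coverU1 Ee' !inE (negPf va) (negPf vb).
  - rewrite coverU1 Ee' !inE (negPf ua) (negPf wa) /=.
    rewrite !negb_or !(contraNN (subsetP coverMe _)) // !andbT -negb_and.
    by apply: contraNN uw => /andP[/eqP-> /eqP->].
(* Otherwise the induction continues from [b] among the edges disjoint from [e], with [e] removed
   from [M] and [e'] from [N]. Adding [e] back bounds the matchings there by [n]. The matching
   obtained misses [a] and [b], so [e'] can be added to it. *)
pose E1 := [set x in E | [disjoint x & e]].
have E1E : E1 \subset E by apply/subsetP => x; rewrite inE => /andP[].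
have disE1 K : matching E1 K -> [disjoint e & cover K].
  move=> /andP[KE1 _]; apply/bigcup_disjointP => x xK.
  by have := subsetP KE1 _ xK; rewrite inE disjoint_sym => /andP[].
have inE1 K : matching E K -> a \notin cover K -> v \notin cover K ->
    matching E1 K.
  move=> /andP[KE trK] aK vK; rewrite /matching trK andbT.
  apply/subsetP => x xK; rewrite inE (subsetP KE) //= disjoint_sym Ee.
  rewrite disjoint_set2; apply/andP; split.
    by apply: contraNN vK; apply: mem_cover.
  by apply: contraNN aK; apply: mem_cover.
have coverNe := coverS (subsetDl N [set e']).
have e0 : e != set0 by apply/set0Pn; exists v.
case: (IHn E1 (M :\ e) (N :\ e') b) => //.
- by move=> x /(subsetP E1E) /E2.
- move=> K mK; have := maxE _ (matchingU1 (matchingS E1E mK) eE (disE1 _ mK)).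
  by rewrite card_matchingU1 ?disE1.
- by apply: inE1 => //; apply: matchingD1.
- apply: inE1; first exact: matchingD1.
    exact: trivIset_notin_coverD1.
  exact: contraNN (subsetP coverNe v) vN.
- exact: contraNN (subsetP coverMe u) uM.
- exact: contraNN (subsetP coverMe w) wM.
- exact: trivIset_notin_coverD1.
move=> K [mK cK bK uwK].
have := disE1 _ mK; rewrite Ee disjoint_set2 => /andP[vK aK].
have dis : [disjoint e' & cover K] by rewrite Ee' disjoint_set2 aK.
have ub : u != b by apply: contraNneq uM => ->.
have wb : w != b by apply: contraNneq wM => ->.
exists (e' |: K); split.
- exact: matchingU1 (matchingS E1E mK) e'E dis.
- by rewrite card_matchingU1 // cK.
- by rewrite coverU1 Ee' !inE (negPf va) (negPf vb).
- by rewrite coverU1 Ee' !inE (negPf ua) (negPf ub) (negPf wa) (negPf wb).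
Qed.

(** * Degree sums and the Chvatal-Hanson bound *)

Lemma sum_degree E (C : {set T}) :
  \sum_(x in C) degree E x = \sum_(A in E) #|A :&: C|.
Proof.
under eq_bigr => x _ do rewrite /degree -sum1_card big_mkcond /=.
rewrite exchange_big /= [RHS]big_mkcond /=; apply: eq_bigr => A _.
case: ifP => AE; last by rewrite big1 // => x _; rewrite inE AE.
rewrite -sum1_card -big_mkcondr /=.
by apply: eq_bigl => x; rewrite !inE AE andbC.
Qed.

(** For [n] at least [uphalf d] the degree sum over [C] gives the bound; for smaller [n] one has
    [n.*2.+1 <= d], and counting all pairs in [C] suffices. *)
Lemma card_edges_within E (C : {set T}) d n :
  uniform 2 E -> (forall x, degree E x <= d) ->
  (forall A, A \in E -> A \subset C) -> #|C| <= n.*2.+1 ->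
  #|E| <= d * n + (uphalf d <= n) * d./2.
Proof.
move=> E2 deg sub cC; have [big|small] := leqP (uphalf d) n.
  have : #|E| * 2 <= #|C| * d.
    rewrite -sum_nat_const -sum_nat_const.
    apply: (@leq_trans (\sum_(x in C) degree E x)); last exact: leq_sum.
    rewrite sum_degree; apply: leq_sum => A AE.
    by rewrite (setIidPl (sub _ AE)) (E2 _ AE).
  have : #|C| * d <= n.*2.+1 * d by rewrite leq_mul2r cC orbT.
  nia.
have : #|E| <= 'C(#|C|, 2).
  rewrite -cards_draws; apply: subset_leq_card; apply/subsetP => A AE.
  by rewrite inE sub // E2.
have : 'C(#|C|, 2) <= 'C(n.*2.+1, 2) by apply: leq_bin2l.
have : n.*2.+1 <= d by lia.
rewrite (bin2 n.*2.+1) /=; nia.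
Qed.

Lemma card_fibers (I J : finType) (p : I -> J) (S : {set I}) :
  #|S| = \sum_j #|[set x in S | p x == j]|.
Proof.
rewrite -sum1_card (partition_big p predT) //=; apply: eq_bigr => j _.
by rewrite -sum1_card; apply: eq_bigl => x; rewrite inE.
Qed.

(* When no vertex lies in all maximum matchings, "u = v or no maximum matching
   misses both u and v" is an equivalence relation; edges lie within classes,
   and a maximum matching misses at most one vertex of each class. *)
Lemma card_edges_missable E d m :
  uniform 2 E -> 0 < d -> (forall x, degree E x <= d) ->
  (forall K, matching E K -> #|K| <= m) ->
  (forall v, exists M, [/\ matching E M, #|M| = m & v \notin cover M]) ->
  (exists2 M, matching E M & #|M| = m) ->
  #|E| <= d * m + d./2 * (m %/ uphalf d).
Proof.
move=> E2 d0 deg maxE miss [M mM cM].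
pose missed u v := [exists K, [&& matching E K, #|K| == m,
                               u \notin cover K & v \notin cover K]].
pose R u v := (u == v) || ~~ missed u v.
have missedP u v K : matching E K -> #|K| = m -> u \notin cover K ->
    v \notin cover K -> missed u v.
  by move=> mK cK uK vK; apply/existsP; exists K; rewrite mK cK eqxx uK vK.
have Rsym : symmetric R.
  move=> u v; rewrite /R eq_sym; congr (_ || ~~ _).
  by apply: eq_existsb => K; congr [&& _, _ & _]; rewrite andbC.
(* Given a maximum matching missing [u] and [w] and another missing [v], the exchange yields one
   that misses [v] together with [u] or [w]. *)
have Rtrans : transitive R.
  move=> v u w; rewrite /R; have [->//|uv] := eqVneq u v.
  have [->|vw] := eqVneq v w; first by move=> /= ->; rewrite orbT.
  move=> /= nuv nvw; have [//|uw /=] := eqVneq u w.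
  apply/negP => /existsP[K /and4P[mK /eqP cK uK wK]].
  have [N [mN cN vN]] := miss v.
  have [L [mL cL vL /orP[uL|wL]]] :=
    matching_exchange E2 maxE mK cK mN cN uw uK wK vN.
  - by rewrite (missedP u v L) in nuv.
  - by rewrite (missedP v w L) in nvw.
pose cls u := [set v | R u v].
have clsE u v : R u v -> cls u = cls v.
  move=> Ruv; apply/setP => w; rewrite !inE.
  exact: (sym_left_transitive Rsym Rtrans).
have self u : u \in cls u by rewrite inE /R eqxx.
have Redge A u v : A \in E -> u \in A -> v \in A -> R u v.
  move=> AE uA vA; rewrite /R; have [//|uv /=] := eqVneq u v.
  apply/negP => /existsP[K /and4P[mK /eqP cK uK vK]].
  have [a au EA] := set2_of_mem (E2 _ AE) uA.
  have av : a = v by move: vA; rewrite EA !inE eq_sym (negPf uv) => /eqP.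
  have dis : [disjoint A & cover K] by rewrite EA av disjoint_set2 uK.
  have A0 : A != set0 by apply/set0Pn; exists u.
  by have := maxE _ (matchingU1 mK AE dis); rewrite card_matchingU1 // cK ltnn.
(* The class containing the edge [A]; the default [set0] is taken only for empty [A], hence never on
   [E]. *)
pose p A := if [pick x in A] is Some x then cls x else set0.
have pE A u : A \in E -> u \in A -> p A = cls u.
  move=> AE uA; rewrite /p; case: pickP => [v vA|/(_ u)]; last by rewrite uA.
  by apply/clsE/(Redge A).
have /andP[/subsetP ME _] := mM.
pose n C := #|[set A in M | p A == C]|.
have sum_n : \sum_C n C = m by rewrite -cM (card_fibers p M).
have bound C : #|[set A in E | p A == C]| <= d * n C + (uphalf d <= n C) * d./2.
  have [->|[A]] := set_0Vmem [set A in E | p A == C]; first by rewrite cards0.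
  rewrite inE => /andP[AE /eqP pA].
  have [u uA] : exists u, u \in A by apply/set0Pn; rewrite -card_gt0 E2.
  have EC : C = cls u by rewrite -pA (pE A u).
  apply: (@card_edges_within _ C).
  - by move=> B; rewrite inE => /andP[/E2].
  - move=> x; apply: leq_trans (deg x); apply: subset_leq_card.
    by apply/subsetP => B; rewrite !inE => /andP[/andP[-> _] ->].
  - move=> B; rewrite inE => /andP[BE /eqP <-]; apply/subsetP => x xB.
    by rewrite (pE B x).
  (* The edges of [M] in the class cover at most twice [n C] of its vertices. Two distinct vertices
     of one class are never both missed by [M], so at most one more remains. *)
  rewrite -(cardsID (cover M) C) -addn1; apply: leq_add; last first.
    apply/card_le1_eqP => x y; rewrite EC !inE => /andP[xM ux] /andP[yM uy].
    have : R x y by apply: Rtrans uy; rewrite Rsym.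
    by rewrite /R (missedP x y M) // orbF => /eqP.
  apply: (@leq_trans #|cover [set A in M | p A == C]|).
    apply/subset_leq_card/subsetP => x /setIP[xC /bigcupP[B BM xB]].
    apply: (@mem_cover B) => //; rewrite inE BM (pE B x) ?ME //=.
    by rewrite EC; apply/eqP/esym/clsE; move: xC; rewrite EC inE.
  apply: leq_trans (leq_card_cover _).1 _.
  rewrite (eq_bigr (fun=> 2)) ?sum_nat_const ?muln2 //.
  by move=> B; rewrite inE => /andP[/ME/E2].
rewrite (card_fibers p E).
apply: (@leq_trans (\sum_C (d * n C + (uphalf d <= n C) * d./2))).
  by apply: leq_sum => C _.
rewrite big_split /= -big_distrr -big_distrl /= sum_n leq_add2l mulnC.
(* A class contributes the extra [d./2] only if it holds at least [uphalf d] of the [m] edges of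
   [M], so at most [m %/ uphalf d] classes do. *)
rewrite leq_mul2l leq_divRL; last by rewrite uphalf_gt0.
apply/orP; right; rewrite -sum_n big_distrl /=; apply: leq_sum => C _.
by case: (leqP (uphalf d) (n C)) => up_n; rewrite ?mul1n ?mul0n.
Qed.

(** Induction on [m]. If every vertex is missed by some matching of size [m.+1], the previous bound
    applies. Otherwise some vertex lies in all of them, and deleting it lowers the matching number
    at the cost of at most [d] edges. *)
Lemma chvatal_hanson E d m :
  uniform 2 E -> 0 < d -> (forall x, degree E x <= d) ->
  (forall K, matching E K -> #|K| <= m) ->
  #|E| <= d * m + d./2 * (m %/ uphalf d).
Proof.
move=> E2 d0; elim: m E E2 => [|m IHm] E E2 deg maxE.
  have [->|[A AE]] := set_0Vmem E; first by rewrite cards0.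
  have dis : [disjoint A & cover set0].
    by rewrite /cover big_set0 -setI_eq0 setI0.
  have A0 : A != set0 by rewrite -card_gt0 E2.
  by have := maxE _ (matchingU1 (matching0 E) AE dis); rewrite card_matchingU1.
have mono : d * m + d + d./2 * (m %/ uphalf d) <=
            d * m.+1 + d./2 * (m.+1 %/ uphalf d).
  by rewrite mulnS (addnC d) leq_add2l leq_mul2l leq_div2r ?orbT.
case: (boolP [exists M, matching E M && (#|M| == m.+1)]) => [|none]; last first.
  apply: leq_trans (leq_trans (IHm E E2 deg _) _) mono.
    move=> K mK; have := maxE _ mK; rewrite leq_eqVlt => /orP[cK|//].
    by case/negP: none; apply/existsP; exists K; rewrite mK.
  by rewrite leq_add2r leq_addr.
move=> /existsP[M /andP[mM /eqP cM]].
case: (boolP [forall v, [exists K, [&& matching E K, #|K| == m.+1 &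
                                    v \notin cover K]]]).
  move=> /forallP miss; apply: card_edges_missable => //; last by exists M.
  by move=> v; have /existsP[K /and3P[mK /eqP cK vK]] := miss v; exists K.
rewrite negb_forall => /existsP[v /existsPn cov].
apply: leq_trans mono; pose E' := [set A in E | v \notin A].
have E'E : E' \subset E by apply/subsetP => A; rewrite inE => /andP[].
have : #|E'| <= d * m + d./2 * (m %/ uphalf d).
  apply: IHm.
  - by move=> A /(subsetP E'E) /E2.
  - move=> x; apply: leq_trans (deg x); apply: subset_leq_card.
    by apply/subsetP => A; rewrite !inE => /andP[/andP[-> _] ->].
  move=> K mK; have := maxE _ (matchingS E'E mK).
  rewrite leq_eqVlt => /orP[/eqP cK|//]; case/negP: (cov K).
  rewrite (matchingS E'E mK) cK eqxx /=; apply/bigcupP => -[A AK vA].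
  by have /andP[/subsetP/(_ A AK)] := mK; rewrite inE vA andbF.
have : #|E| = degree E v + #|E'|.
  rewrite -(cardsID [set A : {set T} | v \in A] E) /degree /E'; congr (_ + _).
    by apply: eq_card => A; rewrite !inE.
  by apply: eq_card => A; rewrite !inE andbC.
have := deg v; lia.
Qed.

(** * Cross-intersecting graphs *)

Definition cross E1 E2 := [forall A in E1, forall B in E2, ~~ [disjoint A & B]].

Lemma crossP E1 E2 :
  reflect (forall A B, A \in E1 -> B \in E2 -> ~~ [disjoint A & B])
          (cross E1 E2).
Proof.
apply: (iffP forall_inP) => [cr A B AE BE|cr A AE].
  exact: (forall_inP (cr A AE)).
by apply/forall_inP => B; apply: cr.
Qed.

Lemma crossC E1 E2 : cross E1 E2 = cross E2 E1.
Proof. by apply/crossP/crossP => cr A B AE BE; rewrite disjoint_sym cr. Qed.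

Lemma crossPn E1 E2 : ~~ cross E1 E2 ->
  exists A B, [/\ A \in E1, B \in E2 & [disjoint A & B]].
Proof.
rewrite negb_forall_in => /exists_inP[A AE].
by rewrite negb_forall_in => /exists_inP[B BE /negPn dis]; exists A, B.
Qed.

Lemma card_hit E (C : {set T}) d :
  (forall x, degree E x <= d) -> (forall A, A \in E -> ~~ [disjoint A & C]) ->
  #|E| <= #|C| * d.
Proof.
move=> deg hit; rewrite -sum_nat_const.
apply: (@leq_trans (\sum_(x in C) degree E x)); last exact: leq_sum.
rewrite sum_degree -sum1_card; apply: leq_sum => A /hit.
by rewrite -setI_eq0 -card_gt0.
Qed.

Lemma set2_of_mem2 A u v : #|A| = 2 -> u \in A -> v \in A -> u != v ->
  A = [set u; v].
Proof.
move=> A2 uA vA uv; have [a _ EA] := set2_of_mem A2 uA.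
by move: vA uv; rewrite EA !inE => /orP[/eqP->|/eqP->//]; rewrite eqxx.
Qed.

(* A graph with no two disjoint edges is a star or a triangle. *)
Lemma card_intersecting E d :
  uniform 2 E -> (forall x, degree E x <= d) -> 3 <= d -> cross E E -> #|E| <= d.
Proof.
move=> E2 deg d3 /crossP crE.
have star a : (forall A, A \in E -> a \in A) -> #|E| <= d.
  move=> allE; apply: leq_trans (deg a); apply: subset_leq_card.
  by apply/subsetP => A AE; rewrite inE AE allE.
case: (boolP [exists a, [forall A in E, a \in A]]) => [/existsP[a /forall_inP]|].
  exact: star.
move=> /existsPn nostar.
have avoid a : exists2 A, A \in E & a \notin A.
  by have := nostar a; rewrite negb_forall_in => /exists_inP[A]; exists A.
have [->|[A AE]] := set_0Vmem E; first by rewrite cards0.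
have /card_gt0P[a aA] : 0 < #|A| by rewrite E2.
have [b ba EA] := set2_of_mem (E2 _ AE) aA.
(* An edge avoiding [a] and one avoiding [b] must both meet [A] and meet each other, which closes a
   triangle [a], [b], [c]. *)
have [B BE aB] := avoid a; have [C CE bC] := avoid b.
have bB : b \in B.
  by have := crE _ _ AE BE; rewrite EA disjoint_set2 aB /= negbK.
have aC : a \in C.
  by have := crE _ _ AE CE; rewrite EA disjoint_set2 bC andbT negbK.
have [c cb EB] := set2_of_mem (E2 _ BE) bB.
have ca : c != a by apply: contraNneq aB => <-; rewrite EB !inE eqxx orbT.
have cC : c \in C.
  by have := crE _ _ BE CE; rewrite EB disjoint_set2 bC /= negbK.
have EC := set2_of_mem2 (E2 _ CE) aC cC _; rewrite eq_sym in EC.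
have {}EC := EC ca.
apply: leq_trans d3.
have c3 : #|[set a; b; c]| <= 3.
  by rewrite -setUA -(add1n 2) cardsU1 leq_add ?leq_b1 // cards2; case: (_ != _).
apply: leq_trans (leq_bin2l 2 c3); rewrite -cards_draws; apply: subset_leq_card.
apply/subsetP => D DE; rewrite inE E2 // eqxx andbT.
apply/subsetP => z zD; rewrite !inE; apply: contraT.
(* An edge with an end [z] outside the triangle would have to meet all three sides in its other end
   [y], but no vertex lies on all three. *)
rewrite !negb_or => /andP[/andP[za zb] zc].
have [y _ ED] := set2_of_mem (E2 _ DE) zD.
have := crE _ _ DE AE; have := crE _ _ DE BE; have := crE _ _ DE CE.
rewrite ED !disjoint_set2 EA EB EC !inE (negPf za) (negPf zb) (negPf zc) /=.
rewrite !negbK.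
move=> yC yB /orP[]/eqP yE; rewrite {}yE in yB yC.
  by move: yB; rewrite eq_sym (negPf ba) eq_sym (negPf ca).
by move: yC; rewrite (negPf ba) eq_sym (negPf cb).
Qed.

Definition transversals A B := [set [set u; v] | u in A, v in B].

Lemma card_transversals A B : #|A| = 2 -> #|B| = 2 -> #|transversals A B| <= 4.
Proof.
move=> A2 B2; rewrite /transversals curry_imset2X.
by apply: leq_trans (leq_imset_card _ _) _; rewrite cardsX A2 B2.
Qed.

Lemma sub_transversals E A B :
  uniform 2 E -> [disjoint A & B] ->
  (forall D, D \in E -> ~~ [disjoint D & A] /\ ~~ [disjoint D & B]) ->
  E \subset transversals A B.
Proof.
move=> E2 dis hit; apply/subsetP => D DE; have [] := hit D DE.
rewrite -!setI_eq0 => /set0Pn[u /setIP[uD uA]] /set0Pn[v /setIP[vD vB]].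
apply/imset2P; exists u v => //; apply: set2_of_mem2 (E2 _ DE) uD vD _.
by apply: contraTneq vB => <-; rewrite (disjointFr dis uA).
Qed.

(** The four edges of the complete bipartite graph between [A] and [B] include two disjoint ones, so
    they cannot all belong to [E]. *)
Lemma card_intersecting_transversals E A B :
  #|A| = 2 -> #|B| = 2 -> [disjoint A & B] ->
  E \subset transversals A B -> cross E E -> #|E| <= 3.
Proof.
move=> A2 B2 dis sub /crossP crE; rewrite leqNgt; apply/negP => E4.
have /eqP EE : E == transversals A B.
  by rewrite eqEcard sub (leq_trans (card_transversals A2 B2)).
have /card_gt0P[a aA] : 0 < #|A| by rewrite A2.
have /card_gt0P[c cB] : 0 < #|B| by rewrite B2.
have [b ba EA] := set2_of_mem A2 aA; have [e ec EB] := set2_of_mem B2 cB.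
have bA : b \in A by rewrite EA !inE eqxx orbT.
have eB : e \in B by rewrite EB !inE eqxx orbT.
have inE_ u v : u \in A -> v \in B -> [set u; v] \in E.
  by move=> uA vB; rewrite EE; apply/imset2P; exists u v.
have := crE _ _ (inE_ a c aA cB) (inE_ b e bA eB).
rewrite disjoint_set2 !inE !negb_or (eq_sym a b) ba (eq_sym c e) ec andbT /=.
have neq u v : u \in A -> v \in B -> u != v.
  by move=> uA vB; apply: contraTneq vB => <-; rewrite (disjointFr dis uA).
by rewrite neq //= eq_sym neq.
Qed.

(** Two disjoint edges [A], [B] of [E1] force all edges of [E2] and [E3] to be transversals of [A]
    and [B]. If [E2] or [E3] also has two disjoint edges, all three graphs have at most 4 edges, and
    [12 <= d.*2 + 6]. Otherwise [E2] and [E3] have at most 3 edges each, and an edge of either one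
    meets all of [E1], so that [E1] has at most [d.*2]. If both are empty, the bound [h] on [E1]
    remains. *)
Lemma card_cross3_nonintersecting E1 E2 E3 d h :
  uniform 2 E1 -> uniform 2 E2 -> uniform 2 E3 ->
  (forall x, degree E1 x <= d) -> 3 <= d -> d.*2 + 6 <= h ->
  cross E1 E2 -> cross E1 E3 -> #|E1| <= h -> ~~ cross E1 E1 ->
  #|E1| + #|E2| + #|E3| <= h.
Proof.
move=> u1 u2 u3 deg d3 dh c12 c13 h1 /crossPn[A [B [AE BE dis]]].
have side E : uniform 2 E -> cross E1 E ->
    [/\ #|E| <= 4, cross E E -> #|E| <= 3, ~~ cross E E -> #|E1| <= 4 &
        E != set0 -> #|E1| <= d.*2].
  move=> uE c1; have sub : E \subset transversals A B.
    by apply: sub_transversals => // D DE; split;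
      rewrite disjoint_sym; apply: (crossP _ _ c1).
  split.
  - apply: leq_trans (card_transversals (u1 _ AE) (u1 _ BE)).
    exact: subset_leq_card.
  - exact: card_intersecting_transversals (u1 _ AE) (u1 _ BE) dis sub.
  - move=> /crossPn[C [D [CE DE disCD]]].
    apply: leq_trans (card_transversals (uE _ CE) (uE _ DE)).
    apply/subset_leq_card/sub_transversals => // X XE.
    by split; apply: (crossP _ _ c1).
  - move=> /set0Pn[C CE]; rewrite -mul2n -(uE _ CE).
    by apply: card_hit => // X XE; apply: (crossP _ _ c1).
have [a2 b2 c2 e2] := side _ u2 c12; have [a3 b3 c3 e3] := side _ u3 c13.
have [i2|/c2] := boolP (cross E2 E2); last lia.
have [i3|/c3] := boolP (cross E3 E3); last lia.
have := b2 i2; have := b3 i3.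
have [z2|/e2] := eqVneq E2 set0; last lia.
have [z3|/e3] := eqVneq E3 set0; last lia.
by rewrite z2 z3 !cards0 !addn0.
Qed.

(** Three intersecting graphs have at most [3 * d] edges together; otherwise one that is not
    intersecting takes the first place in the previous lemma. *)
Lemma card_cross3 E1 E2 E3 d h :
  uniform 2 E1 -> uniform 2 E2 -> uniform 2 E3 ->
  (forall x, degree E1 x <= d) -> (forall x, degree E2 x <= d) ->
  (forall x, degree E3 x <= d) -> 3 <= d -> 3 * d <= h -> d.*2 + 6 <= h ->
  cross E1 E2 -> cross E1 E3 -> cross E2 E3 ->
  #|E1| <= h -> #|E2| <= h -> #|E3| <= h ->
  #|E1| + #|E2| + #|E3| <= h.
Proof.
move=> u1 u2 u3 g1 g2 g3 d3 dh dh' c12 c13 c23 h1 h2 h3.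
have [i1|] := boolP (cross E1 E1); last first.
  exact: card_cross3_nonintersecting g1 d3 dh' c12 c13 h1.
have [i2|n2] := boolP (cross E2 E2); last first.
  rewrite (addnC #|E1|); rewrite crossC in c12.
  exact: card_cross3_nonintersecting g2 d3 dh' c12 c23 h2 n2.
have [i3|n3] := boolP (cross E3 E3); last first.
  rewrite addnC addnA; rewrite crossC in c13; rewrite crossC in c23.
  exact: card_cross3_nonintersecting g3 d3 dh' c13 c23 h3 n3.
have := card_intersecting u1 g1 d3 i1; have := card_intersecting u2 g2 d3 i2.
have := card_intersecting u3 g3 d3 i3; lia.
Qed.

Implicit Types F G : {set {set T}}.

(** * Links and sunflowers *)

Definition link F x :=
  [set A : {set T} | (x \notin A) && (x |: A \in F)].

Lemma card_link F x : #|link F x| = degree F x.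
Proof.
have inj : {in link F x &, injective (fun A => x |: A)}.
  move=> A B; rewrite !inE => /andP[xA _] /andP[xB _] eqAB.
  by rewrite -(setU1K xA) eqAB setU1K.
rewrite -(card_in_imset inj); apply: eq_card => A; rewrite !inE.
apply/imsetP/andP => [[B + ->]|[AF xA]].
  by rewrite inE => /andP[_ BF]; rewrite BF setU11.
exists (A :\ x); last by rewrite setD1K.
by rewrite inE setD11 setD1K.
Qed.

Lemma linkS F G x : F \subset G -> link F x \subset link G x.
Proof.
move=> /subsetP FG; apply/subsetP => A.
by rewrite !inE => /andP[xA AF]; rewrite xA FG.
Qed.

Lemma uniform_link n F x : uniform n.+1 F -> uniform n (link F x).
Proof.
by move=> unif A; rewrite inE => /andP[xA /unif]; rewrite cardsU1 xA add1n => -[].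
Qed.

Lemma sunflower_freeS k F G :
  F \subset G -> sunflower_free k G -> sunflower_free k F.
Proof.
move=> FG free [S [SF sunS]]; apply: free; exists S; split=> //.
exact: subset_trans FG.
Qed.

(** Adding [x] to all petals and to the core turns a sunflower of the link into one of [F]. *)
Lemma sunflower_free_link k F x :
  sunflower_free k F -> sunflower_free k (link F x).
Proof.
move=> free [S [/subsetP SF [cardS [C coreC]]]]; apply: free.
have inj : {in S &, injective (fun A => x |: A)}.
  move=> A B /SF + /SF; rewrite !inE => /andP[xA _] /andP[xB _] eqAB.
  by rewrite -(setU1K xA) eqAB setU1K.
exists [set x |: A | A in S]; split.
  by apply/subsetP => _ /imsetP[A /SF + ->]; rewrite inE => /andP[].
split; first by rewrite card_in_imset.
exists (x |: C) => _ _ /imsetP[A AS ->] /imsetP[B BS ->] neq.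
by rewrite -setUIr coreC //; apply: contraNneq neq => ->.
Qed.

(** A sunflower has a prescribed number of members; from a larger [S] one selects exactly [r.+1]
    sets, which keep the core [C]. *)
Lemma card_sunflower r F (S : {set {set T}}) C :
  sunflower_free r.+1 F -> S \subset F ->
  (forall A B, A \in S -> B \in S -> A != B -> A :&: B = C) -> #|S| <= r.
Proof.
move=> free SF core; rewrite leqNgt; apply/negP => /card_geqP[s [us sz sS]].
apply: free; exists [set A in s]; split.
  by apply/subsetP => A; rewrite inE => /sS; apply: (subsetP SF).
split; first by rewrite cardsE (card_uniqP us).
by exists C => A B; rewrite !inE => /sS AS /sS BS; apply: core.
Qed.

Lemma sunflower_free_matching r F M :
  sunflower_free r.+1 F -> matching F M -> #|M| <= r.
Proof.
move=> free /andP[MF /trivIsetP trM].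
apply: (card_sunflower (C := set0) free MF) => A B AM BM AB.
by apply/eqP; rewrite setI_eq0 trM.
Qed.

(** The edges through [x] form a sunflower with core [[set x]]. *)
Lemma sunflower_free_degree r E x :
  uniform 2 E -> sunflower_free r.+1 E -> degree E x <= r.
Proof.
move=> E2 free; apply: (card_sunflower (C := [set x]) free).
  by apply/subsetP => A; rewrite inE => /andP[].
move=> A B; rewrite !inE => /andP[AE xA] /andP[BE xB] AB.
apply/setP => y; rewrite !inE; apply/andP/eqP => [[yA yB]|->//].
apply: contra_neq_eq AB; rewrite eq_sym => xy.
by rewrite (set2_of_mem2 (E2 _ AE) xA yA xy) (set2_of_mem2 (E2 _ BE) xB yB xy).
Qed.

(** * Counting triples around a maximum matching *)

Definition graph_bound d m := d * m + d./2 * (m %/ uphalf d).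

(* V is the vertex set of a maximum matching M, and F1 consists of the triples
   meeting V in a single vertex. Since A is in F1 or meets V twice, 2|F| is
   bounded by sums of degrees over V. *)
Lemma card_triples r F :
  uniform 3 F -> sunflower_free r.+1 F -> 3 <= r ->
  3 * r <= graph_bound r r.-1 -> r.*2 + 6 <= graph_bound r r.-1 ->
  2 * #|F| <= r * (3 * graph_bound r r + graph_bound r r.-1).-1.
Proof.
set g := graph_bound r r; set h := graph_bound r r.-1 => F3 free r3 hr hr'.
have r0 : 0 < r by apply: leq_trans r3.
pose M := [arg max_(M > set0 | matching F M) #|M|].
have [mM maxM] : matching F M /\ forall K, matching F K -> #|K| <= #|M|.
  by rewrite /M; case: arg_maxnP => //; apply: matching0.
have cM : #|M| <= r := sunflower_free_matching free mM.
have /andP[/subsetP MF trM] := mM.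
pose V := cover M; pose F1 := [set A in F | #|A :&: V| == 1].
have F1F : F1 \subset F by apply/subsetP => A; rewrite inE => /andP[].
have set3_neq0 A : A \in F -> A != set0 by move=> AF; rewrite -card_gt0 F3.
have hitV A : A \in F -> 0 < #|A :&: V|.
  move=> AF; rewrite card_gt0 setI_eq0; apply/negP => dis.
  have := maxM _ (matchingU1 mM AF dis).
  by rewrite card_matchingU1 ?set3_neq0 // ltnn.
(* The inequality holds triple by triple: a member of [M] has all three vertices in [V], while any
   other member of [F] either meets [V] at least twice or meets it once and is counted again in
   [F1]. *)
have count : 2 * #|F| + #|M| <= \sum_(x in V) (degree F x + degree F1 x).
  rewrite big_split /= !sum_degree.
  have -> : \sum_(A in F1) #|A :&: V| = \sum_(A in F) (#|A :&: V| == 1).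
    rewrite [RHS]big_mkcond [LHS]big_mkcond /=; apply: eq_bigr => A _.
    by rewrite inE; case: (A \in F) => //=; case: eqP.
  have -> : #|M| = \sum_(A in F) (A \in M).
    rewrite -sum1_card [RHS]big_mkcond [LHS]big_mkcond /=; apply: eq_bigr => A _.
    by case: (boolP (A \in M)) => [/MF->|_]; last case: ifP.
  rewrite mulnC -sum_nat_const -!big_split /=; apply: leq_sum => A AF.
  have := hitV A AF; case: (boolP (A \in M)) => [AM _|_ ].
    by rewrite (setIidPl _) ?F3 //; apply: (bigcup_sup A).
  by case: #|_| => [|[|]].
have uF x := uniform_link (x := x) F3.
have uF1 x : uniform 2 (link F1 x).
  by apply: uniform_link => A /(subsetP F1F)/F3.
have freeF x := sunflower_free_link (x := x) free.
have freeF1 x : sunflower_free r.+1 (link F1 x).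
  exact/sunflower_free_link/(sunflower_freeS F1F).
have degF x y := sunflower_free_degree y (uF x) (freeF x).
have degF1 x y := sunflower_free_degree y (uF1 x) (freeF1 x).
have gF x : degree F x <= g.
  rewrite -card_link; apply: chvatal_hanson (uF x) r0 (degF x) _ => K.
  exact: sunflower_free_matching.
have outV x B : x \in V -> B \in link F1 x -> [disjoint B & V].
  move=> xV; rewrite !inE => /andP[xB /andP[_ /eqP cV]].
  rewrite -setI_eq0 -cards_eq0; move: cV.
  rewrite (cardsD1 x) !inE eqxx xV add1n => -[cV].
  rewrite -leqn0 -cV; apply: subset_leq_card; apply/subsetP => y.
  rewrite !inE => /andP[yB ->]; rewrite yB orbT !andbT.
  by apply: contraNneq xB => <-.
have eV e : e \in M -> e \subset V by move=> eM; apply: (bigcup_sup e).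
have hF1 e x : e \in M -> x \in e -> #|link F1 x| <= h.
  move=> eM xe; have xV := subsetP (eV e eM) _ xe.
  apply: (chvatal_hanson (uF1 x) r0 (degF1 x)) => K mK.
  have ex : e :\ x \in link F x by rewrite inE setD11 setD1K //= MF.
  have dis : [disjoint e :\ x & cover K].
    apply/bigcup_disjointP => B BK; rewrite disjoint_sym.
    apply: disjointWr (outV x B xV _); last by case/andP: mK => /subsetP->.
    exact: subset_trans (subsetDl _ _) (eV e eM).
  have ex0 : e :\ x != set0 by rewrite -card_gt0 (uF x).
  have mK' := matchingU1 (matchingS (linkS x F1F) mK) ex dis.
  have := sunflower_free_matching (freeF x) mK'.
  by rewrite card_matchingU1 // => Kr; rewrite -ltnS prednK.
have crossF1 e x y : e \in M -> x \in e -> y \in e -> x != y ->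
    cross (link F1 x) (link F1 y).
  (* Disjoint [B] and [D] would allow [x |: B] and [y |: D] to replace [e] in [M], giving a larger
     matching. *)
  move=> eM xe ye xy; apply/crossP => B D Bx Dy; apply/negP => disBD.
  have xV := subsetP (eV e eM) _ xe; have yV := subsetP (eV e eM) _ ye.
  have disB := outV x B xV Bx; have disD := outV y D yV Dy.
  have xBF : x |: B \in F.
    by have := subsetP (linkS x F1F) _ Bx; rewrite inE => /andP[].
  have yDF : y |: D \in F.
    by have := subsetP (linkS y F1F) _ Dy; rewrite inE => /andP[].
  have subV : cover (M :\ e) \subset V := coverS (subsetDl M [set e]).
  have disU z (X : {set T}) : z \in e -> [disjoint X & V] ->
      [disjoint z |: X & cover (M :\ e)].
    move=> ze disX; rewrite disjoint_setU1.
    by rewrite (trivIset_notin_coverD1 trM eM ze) (disjointWr subV).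
  have mD := matchingU1 (matchingD1 e mM) yDF (disU _ _ ye disD).
  have disBD' : [disjoint x |: B & cover ((y |: D) |: (M :\ e))].
    rewrite coverU1 -setI_eq0 setIUr setU_eq0 !setI_eq0 disU // andbT.
    rewrite disjoint_setU1 !inE negb_or xy (disjointFl disD xV) /=.
    by rewrite disjoint_sym disjoint_setU1 (disjointFl disB yV) disjoint_sym.
  have := maxM _ (matchingU1 mD xBF disBD').
  rewrite !card_matchingU1 ?set3_neq0 ?disU //.
  by rewrite [X in _ <= X](cardsD1 e) eM add1n ltnn.
have local e : e \in M ->
    \sum_(x in e) (degree F x + degree F1 x) <= 3 * g + h.
  move=> eM; have e3 : #|e| = 3 by apply: F3; apply: MF.
  rewrite big_split /=; apply: leq_add.
    by rewrite -e3 -sum_nat_const; apply: leq_sum.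
  have /card_gt0P[x xe] : 0 < #|e| by rewrite e3.
  have ex2 : #|e :\ x| = 2 by move: e3; rewrite (cardsD1 x) xe add1n => -[].
  have /card_gt0P[y yex] : 0 < #|e :\ x| by rewrite ex2.
  have [z zy Ee] := set2_of_mem ex2 yex.
  have zex : z \in e :\ x by rewrite Ee !inE eqxx orbT.
  move: (yex) (zex); rewrite !inE => /andP[yx ye] /andP[zx ze].
  rewrite (big_setD1 x) //= Ee big_setU1 ?inE 1?eq_sym //= big_set1 addnA.
  rewrite -!card_link; apply: (@card_cross3 _ _ _ r) => //.
  - by apply: crossF1 eM xe ye _; rewrite eq_sym.
  - by apply: crossF1 eM xe ze _; rewrite eq_sym.
  - by apply: crossF1 eM ye ze _; rewrite eq_sym.
  - exact: hF1 xe.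
  - exact: hF1 ye.
  - exact: hF1 ze.
have total : \sum_(x in V) (degree F x + degree F1 x) <= #|M| * (3 * g + h).
  by rewrite big_trivIset //= -sum_nat_const; apply: leq_sum.
(* Moving the term [#|M|] to the right takes 1 off the share of each matching triple; what remains
   grows with [#|M|], which is at most [r]. *)
have : #|M| * (3 * g + h).-1 <= r * (3 * g + h).-1 by rewrite leq_mul2r cM orbT.
apply: leq_trans; rewrite -subn1 mulnBr muln1.
by rewrite leq_subRL; [rewrite addnC (leq_trans count)|nia].
Qed.

End Matchings.

(** * The numerical bounds *)

Lemma f3_bound r :
  3 <= r -> 3 * r <= graph_bound r r.-1 -> r.*2 + 6 <= graph_bound r r.-1 ->
  2 * f 3 r.+1 <= r * (3 * graph_bound r r + graph_bound r r.-1).-1.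
Proof.
move=> r3 hr hr'; have [[T [F [F3 free <-]]] _] := f_max 3 (ltn0Sn r).
exact: card_triples.
Qed.

Theorem corollary4p3 : f 3 5 <= 146 /\ f 3 6 <= 255 /\ f 3 7 <= 474.
Proof.
(* The side conditions hold by computation, the last one with equality 14 = 14 for [r = 4]. The
   right-hand sides evaluate to 292, 510 and 948, twice the claimed bounds. *)
have b5 := @f3_bound 4 isT isT isT; have b6 := @f3_bound 5 isT isT isT.
have b7 := @f3_bound 6 isT isT isT.
by split; [|split]; rewrite -(leq_pmul2l (m := 2)).
Qed.
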